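(* Let $\alpha,\beta,\lambda>0$. Let $Y_\alpha\sim\mathcal{G}a(\alpha)$ and $Y_i\sim\mathcal{G}a(1)$, $i=1,2,\dots$, be mutually independent, and let $X_i=\beta\,Y_i/Y_\alpha$ for $i\ge 1$. Let $N$ be a Poisson random variable with parameter $\lambda$, independent of $(X_i)_{i\ge1}$, and let $S_N=X_1+\dots+X_N$ (with $S_N=0$ if $N=0$). Then the distribution of $S_N$ has an atom at $0$ of mass $\Pr(S_N=0)=e^{-\lambda}$, and on $(0,\infty)$ it has density $$f_{S_N}(x;\alpha,\lambda,\beta)=\frac{\alpha\lambda e^{-\lambda}}{\beta(1+x/\beta)^{\alpha+1}}\;{}_1F_1\left[1+\alpha;2;\frac{\lambda x/\beta}{1+x/\beta}\right],\quad x>0.$$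
   Context: For $a>0$, $\mathcal{G}a(a)$ denotes the gamma distribution with probability density function $x^{a-1}e^{-x}/\Gamma(a)$ for $x>0$. ${}_1F_1[a;b;z]=\sum_{n=0}^\infty\frac{(a)_n z^n}{(b)_n n!}$ is the Kummer confluent hypergeometric function, where $(a)_n=a(a+1)\cdots(a+n-1)$, $(a)_0=1$, is the rising Pochhammer symbol. *)

(* Defs.v *)
From HB Require Import structures.
From mathcomp Require Import all_boot all_order all_algebra finmap.
From mathcomp Require Import all_classical all_reals all_analysis.
From mathcomp Require Import measurable_realfun.

Set Implicit Arguments.
Unset Strict Implicit.
Unset Printing Implicit Defensive.

Import Order.TTheory GRing.Theory Num.Theory.
Import numFieldNormedType.Exports.

Local Open Scope classical_set_scope.
Local Open Scope ring_scope.

Section special_functions.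
Context {R : realType}.
Implicit Types a b x z : R.

Definition Gamma_fun a : R :=
  \int[lebesgue_measure]_(x in `]0, +oo[) (x `^ (a - 1) * expR (- x)).

Definition pochhammer a (n : nat) : R := \prod_(i < n) (a + i%:R).

(* The sum of the power series when it converges, a junk value otherwise. *)
Definition kummer1F1 a b z : R :=
  limn (series (fun n => pochhammer a n * z ^+ n / (pochhammer b n * n`!%:R))).

(* Extended by 0 outside the open half-line. *)
Definition gamma_pdf a : R -> R :=
  (fun x => x `^ (a - 1) * expR (- x) / Gamma_fun a) \_ `]0, +oo[.

End special_functions.

Section laws_and_independence.
Context d (T : measurableType d) (R : realType) (P : probability T R).
Local Open Scope ereal_scope.

Definition gamma_distributed (a : R) (Y : {RV P >-> R}) : Prop :=
  forall A : set R, measurable A ->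
    distribution P Y A = \int[lebesgue_measure]_(x in A) (gamma_pdf a x)%:E.

Definition poisson_distributed (r : R) (N : {RV P >-> nat}) : Prop :=
  forall k : nat, distribution P N [set k] = (poisson_pmf r k)%:E.

(* Product rule over every finite subfamily; the value of [B] outside [J] is
   irrelevant. *)
Definition mutually_independent (I : choiceType) (Z : I -> {RV P >-> R}) : Prop :=
  forall (J : {fset I}) (B : I -> set R), (forall i, measurable (B i)) ->
    P (\bigcap_(i in [set` J]) (Z i @^-1` B i)) =
    \prod_(i <- J) P (Z i @^-1` B i).

Definition sigma_family (I : Type) (Z : I -> {RV P >-> R}) : set (set T) :=
  <<s \bigcup_i preimage_set_system [set: T] (Z i) measurable >>.

Definition independent_of_family d' (U : measurableType d') (N : {RV P >-> U})
    (I : Type) (Z : I -> {RV P >-> R}) : Prop :=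
  forall (A : set U) (E : set T), measurable A -> sigma_family Z E ->
    P ((N @^-1` A) `&` E) = P (N @^-1` A) * P E.

End laws_and_independence.

Section measurability.
Context {R : realType}.

Lemma measurable_invr : measurable_fun [set: R] (@GRing.inv R).
Proof.
rewrite -(setUv [set 0 : R]); apply/measurable_funU => //.
  exact: measurableC.
split.
- apply: (eq_measurable_fun (cst (0 : R))); last exact: measurable_cst.
  by move=> x /[!inE] /= ->; rewrite invr0.
- apply: open_continuous_measurable_fun.
    exact: closed_openC.
  by move=> x /[!inE] /= /eqP x0; exact: inv_continuous.
Qed.

End measurability.

Section random_variables.
Context d (T : measurableType d) (R : realType).

(* Division by zero yields 0, so this is total; it only departs from the
   mathematical quotient on the event [Z = 0]. *)
Definition scaled_ratio (b : R) (Y Z : {mfun T >-> R}) : T -> R :=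
  fun w => b * Y w / Z w.

Lemma measurable_scaled_ratio b Y Z :
  measurable_fun [set: T] (scaled_ratio b Y Z).
Proof.
apply: measurable_funM; first exact: measurable_funM.
exact: measurableT_comp measurable_invr _.
Qed.

HB.instance Definition _ b Y Z := isMeasurableFun.Build _ _ _ _
  (scaled_ratio b Y Z) (measurable_scaled_ratio b Y Z).

(* The summands are indexed from 0: [X i] is the (i+1)-st term. *)
Definition random_sum (N : {mfun T >-> nat}) (X : nat -> {mfun T >-> R}) : T -> R :=
  fun w => \sum_(i < N w) X i w.

Lemma measurable_random_sum N X : measurable_fun [set: T] (random_sum N X).
Proof.
move=> _ B mB; rewrite setTI.
rewrite [X in measurable X](_ : _ = \bigcup_k
  (N @^-1` [set k] `&` (fun w => \sum_(i < k) X i w) @^-1` B)); last first.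
  apply/seteqP; split=> [w Bw|w [k _ [/= Nk]]].
    by exists (N w) => //; split.
  by rewrite /random_sum /= Nk.
apply: bigcupT_measurable => k; apply: measurableI.
  by rewrite -[X in measurable X]setTI; exact: measurable_funP.
rewrite -[X in measurable X]setTI.
have mS : measurable_fun [set: T] (fun w => \sum_(i < k) X i w).
  exact: measurable_sum.
exact: mS.
Qed.

HB.instance Definition _ N X := isMeasurableFun.Build _ _ _ _
  (random_sum N X) (measurable_random_sum N X).

End random_variables.

(* Main.v *)
(* Given [Yalpha = y], each [X i] is a rescaled exponential variable, so the sum
   of [n.+1] of them, namely [beta * W / Yalpha] with [W] an Erlang variable,
   has for density a mixture of Erlang densities over the gamma law of [Yalpha];
   Tonelli and a linear change of variables turn it into
   [Gamma (alpha + n.+1) / Gamma alpha * (x / beta) ^ n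
    / (n! * beta * (1 + x / beta) ^ (alpha + n.+1))].
   Weighting by the Poisson probabilities of [N = n.+1] and summing over [n]
   gives the Kummer series term by term. *)
Require Import Defs.
From HB Require Import structures.
From mathcomp Require Import all_boot all_order all_algebra finmap.
From mathcomp Require Import all_classical all_reals all_analysis.
From mathcomp Require Import ring lra measurable_realfun.

Set Implicit Arguments.
Unset Strict Implicit.
Unset Printing Implicit Defensive.

Import Order.TTheory GRing.Theory Num.Theory.
Import numFieldNormedType.Exports.

Local Open Scope classical_set_scope.
Local Open Scope ring_scope.

(** * Lebesgue integrals on the real line *)

Section lebesgue_integral_real_line.
Context {R : realType}.
Local Notation mu := (@lebesgue_measure R).
Implicit Types (a c t x : R).

(** The [X i] share the denominator [Yalpha], hence are dependent: convolution takes place on the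
    numerators alone, and [Yalpha] enters once, through the quotient. No conditional law is formed.
    Conditioning on [Yalpha] is replaced by the product density of an independent pair, obtained
    from uniqueness of measures on rectangles; the same uniqueness upgrades the product rule over
    finite subfamilies to independence of a partial sum from the variables outside it. Domains
    become indicators on the whole line before integrals are exchanged, so each exchange is Tonelli
    for a nonnegative function on the plane. The gamma recurrence lives in the extended reals, where
    it makes sense before the gamma integral is known to be finite. That finiteness is read off the
    law of [Yalpha]: its total mass one excludes a zero [Gamma_fun alpha], and zero is the value
    that [Gamma_fun] would give to a divergent integral. *)

Lemma measurable_affine c t :
  measurable_fun [set: measurableTypeR R]
    (fun x => c * x + t : measurableTypeR R).
Proof. by apply: measurable_funD => //; exact: measurable_funM. Qed.

(** Lebesgue measure is determined by its values on half-open intervals, and the preimage of such an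
    interval is one shorter by the factor [c]. As an identity of measures it yields the change of
    variables without any regularity of the integrand. *)
Lemma lebesgue_measure_affine c t (A : set R) : 0 < c -> measurable A ->
  (mu A = c%:E * mu ((fun x => c * x + t)%R @^-1` A))%E.
Proof.
move=> c_gt0 mA; have c0 := ltW c_gt0.
apply: (lebesgue_measure_unique (mu := mscale (NngNum c0) (pushforward mu
  (fun x : measurableTypeR R => c * x + t : measurableTypeR R)))) => //.
  exact: measurable_affine.
move=> ? /= _ [[a b]] _ <-.
rewrite /mscale/= /pushforward/=.
rewrite (_ : _ @^-1` _ = `](a - t) / c, (b - t) / c]%classic); last first.
  apply/seteqP; split=> x /=; rewrite !in_itv/= ltr_pdivrMr// ler_pdivlMr//;
    by rewrite ltrBlDr lerBrDr mulrC.
rewrite !lebesgue_measure_itv/= !lte_fin ltr_pM2r ?invr_gt0// ltrD2r.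
case: ifP => _; last by rewrite mule0.
by rewrite -!EFinB -EFinM; congr EFin; field; rewrite gt_eqF.
Qed.

Lemma ge0_integral_affine c t (f : R -> \bar R) : 0 < c ->
  measurable_fun [set: R] f -> (forall x, 0 <= f x)%E ->
  (\int[mu]_x f x = c%:E * \int[mu]_x f (c * x + t)%R)%E.
Proof.
move=> c_gt0 mf f0; have c0 := ltW c_gt0.
have mA := measurable_affine c t.
rewrite (eq_measure_integral (mscale (NngNum c0) (pushforward mu
    (fun x : measurableTypeR R => c * x + t : measurableTypeR R)))); last first.
  by move=> A mA' _; exact: lebesgue_measure_affine.
by rewrite ge0_integral_mscale//= ge0_integral_pushforward//= preimage_setT.
Qed.

Lemma integral_itvoy_expRM a x : 0 < x ->
  (\int[mu]_(c in `]a, +oo[) (x * expR (- (c * x)))%:E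
   = (expR (- (a * x)))%:E)%E.
Proof.
move=> x0.
have dF c : is_derive c 1 (fun c => - expR (- (c * x))) (x * expR (- (c * x))).
  by apply: is_derive_eq; rewrite /GRing.scale/=; ring.
have cf : continuous (fun c : R => x * expR (- (c * x))).
  move=> c; apply: cvgM; first exact: cvg_cst.
  apply: continuous_comp; last exact: continuous_expR.
  by apply: cvgN; apply: cvgM => //; exact: cvg_cst.
rewrite integral_itv_obnd_cbnd; last first.
  apply/measurable_EFinP/measurable_funTS.
  exact: continuous_measurable_fun.
rewrite (@ge0_continuous_FTC2y _ _ (fun c => - expR (- (c * x))) _ 0)//.
- by rewrite EFinN oppeK add0e.
- by move=> c _; rewrite mulr_ge0 ?expR_ge0// ltW.
- exact: continuous_subspaceT.
- rewrite -oppr0; apply: cvgN.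
  apply: (@cvg_comp _ _ _ (fun c => c * x) (fun z => expR (- z)) _ (pinfty_nbhs R)).
    exact: gt0_cvgMly.
  exact: cvgr_expR.
- apply: cvg_at_right_filter.
  apply: cvgN; apply: continuous_comp; last exact: continuous_expR.
  by apply: cvgN; apply: cvgM => //; exact: cvg_cst.
- by move=> c _; rewrite derive1E derive_val.
Qed.

Lemma integral_itv1y_powRN a : 0 < a ->
  (\int[mu]_(c in `]1%R, +oo[) (c `^ (- a - 1))%:E = (a^-1)%:E)%E.
Proof.
move=> a0.
have dF c : 0 < c ->
    is_derive c 1 (fun c => - (a^-1 * c `^ (- a))) (c `^ (- a - 1)).
  move=> c0; have := is_derive1_powR (- a) c0 => ?.
  apply: is_derive_eq; rewrite /GRing.scale/=; field; exact: lt0r_neq0.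
rewrite integral_itv_obnd_cbnd; last first.
  by apply/measurable_EFinP/measurable_funTS; exact: measurable_powR.
have cp r : {within `[1, +oo[, continuous (fun c : R => c `^ r)}.
  apply: derivable_within_continuous => c; rewrite in_itv/= andbT => c1.
  by apply: derivable_powR; rewrite in_itv/= andbT (lt_le_trans ltr01).
rewrite (@ge0_continuous_FTC2y _ _ (fun c => - (a^-1 * c `^ (- a))) _ 0)//.
- by rewrite powR1 mulr1 EFinN oppeK add0e.
- by move=> c _; rewrite powR_ge0.
- rewrite -oppr0 -(mulr0 a^-1); apply: cvgN; apply: cvgM; first exact: cvg_cst.
  have : (fun z => expR (- z)) \o (fun c => a * ln c) @ +oo --> (0:R).
    apply: (@cvg_comp _ _ _ _ _ _ (pinfty_nbhs R)); last exact: cvgr_expR.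
    apply: gt0_cvgMry => //; apply/cvgryPge => r; near=> c.
    rewrite -(expRK r) ler_ln ?posrE ?expR_gt0//; near: c;
      by [exact: nbhs_pinfty_ge|exact: nbhs_pinfty_gt].
  apply: cvg_trans; apply: near_eq_cvg; near=> c => /=.
  rewrite /powR gt_eqF ?mulNr//; near: c; exact: nbhs_pinfty_gt.
- by move=> c c1; have := dF c (lt_trans ltr01 c1) => -[].
- apply: cvgN; apply: cvgM; first exact: cvg_cst.
  by have /continuous_within_itvcyP[] := cp (- a).
- move=> c; rewrite in_itv/= andbT => c1; rewrite derive1E.
  by have := dF c (lt_trans ltr01 c1) => ?; rewrite derive_val.
Unshelve. all: by end_near. Qed.

End lebesgue_integral_real_line.

(** * The gamma function *)

Section gamma_integral.
Context {R : realType}.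
Local Notation mu := (@lebesgue_measure R).
Implicit Types (a c x : R).

Lemma integral_indicM d (T : measurableType d) (m : {measure set T -> \bar R})
    (D : set T) (f : T -> R) :
  (\int[m]_(x in D) (f x)%:E = \int[m]_x (\1_D x * f x)%:E)%E.
Proof.
rewrite integral_mkcond; apply: eq_integral => x _.
by rewrite patchE indicE; case: (x \in D); rewrite ?mul1r ?mul0r.
Qed.

Lemma indic_itvoy a x : (\1_`]a, +oo[ : R -> R) x = (a < x)%R%:R.
Proof.
rewrite indicE; congr (nat_of_bool _)%:R.
by apply/idP/idP; rewrite ?in_setE/= in_itv/= andbT.
Qed.

(** [Gamma_fun a] is the [fine] part of this integral; the extended value keeps divergence visible
    instead of turning it into 0. *)
Definition Gamma_integral a : \bar R :=
  (\int[mu]_(x in `]0%R, +oo[) (x `^ (a - 1) * expR (- x))%:E)%E.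

Lemma Gamma_integral_ge0 a : (0 <= Gamma_integral a)%E.
Proof.
by apply: integral_ge0 => x _; rewrite lee_fin mulr_ge0 ?powR_ge0 ?expR_ge0.
Qed.

Lemma measurable_powR_expR a c :
  measurable_fun [set: R] (fun x => x `^ a * expR (- (c * x))).
Proof.
apply: measurable_funM; first exact: measurable_powR.
by apply: measurableT_comp => //; apply: measurableT_comp => //; exact: measurable_funM.
Qed.

Lemma integral_powR_expR a c : 0 < c ->
  (\int[mu]_(x in `]0%R, +oo[) (x `^ (a - 1) * expR (- (c * x)))%:E
   = (c `^ (- a))%:E * Gamma_integral a)%E.
Proof.
move=> c0; rewrite /Gamma_integral integral_indicM [in RHS]integral_indicM.
rewrite [in RHS](@ge0_integral_affine _ c 0)//; last 2 first.
  apply/measurable_EFinP; apply: measurable_funM => //.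
  under eq_fun do rewrite -[X in expR (- X)]mul1r.
  exact: measurable_powR_expR.
  by move=> x; rewrite lee_fin !mulr_ge0 ?powR_ge0 ?expR_ge0.
rewrite muleA -EFinM -ge0_integralZl_EFin//; last 3 first.
- by move=> x _; rewrite lee_fin !mulr_ge0 ?powR_ge0 ?expR_ge0.
- apply/measurable_EFinP; apply: measurable_funM.
    apply: measurableT_comp; first exact: measurable_indic.
    exact: measurable_affine.
  apply: (measurableT_comp (f := fun x => x `^ (a - 1) * expR (- x))).
    under eq_fun do rewrite -[X in expR (- X)]mul1r.
    exact: measurable_powR_expR.
  exact: measurable_affine.
- by rewrite mulr_ge0 ?powR_ge0// ltW.
apply: eq_integral => x _; rewrite -EFinM addr0; congr EFin.
rewrite !indic_itvoy pmulr_rgt0//.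
case: (ltP 0 x) => x0; last by rewrite !mul0r mulr0.
rewrite !mul1r powRM// ?ltW//.
(* The powers of [c] cancel: [c ^ (- a)] from the statement, [c] from the Jacobian, [c ^ (a - 1)]
   from the integrand. *)
rewrite !mulrA [X in X * _ * _](_ : _ = 1) ?mul1r//.
rewrite -[X in _ * X * _](powRr1 (ltW c0)) -!powRD ?(gt_eqF c0) ?implybT//.
by rewrite (_ : - a + 1 + (a - 1) = 0) ?powRr0//; ring.
Qed.

(* Integration by parts is avoided: [expR (- x) / x] is the integral of
   [expR (- (c * x))] over [c > 1], and exchanging integrals leaves a power
   of [c]. *)
Lemma Gamma_integralD1 a : 0 < a ->
  (Gamma_integral (a + 1) = a%:E * Gamma_integral a)%E.
Proof.
move=> a0.
(* The exchange produces [a^-1] as the integral of [c ^ (- a - 1)] over [c > 1], hence the divided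
   form. Passing back uses only that [a] is nonzero, so infinite values are covered. *)
suff -> : (Gamma_integral a = (a^-1)%:E * Gamma_integral (a + 1))%E.
  by rewrite muleA -EFinM divff ?gt_eqF// mul1e.
pose g (z : R * R) := (\1_`]0, +oo[ z.1 *
  (\1_`]1, +oo[ z.2 * (z.1 `^ a * expR (- (z.2 * z.1)))))%:E.
have g_ge0 z : (0 <= g z)%E.
  by rewrite lee_fin !mulr_ge0 ?powR_ge0 ?expR_ge0.
have mg : measurable_fun [set: R * R] g.
  apply/measurable_EFinP; apply: measurable_funM.
    by apply: measurableT_comp => //; exact: measurable_indic.
  apply: measurable_funM.
    by apply: measurableT_comp => //; exact: measurable_indic.
  apply: measurable_funM.
    by apply: measurableT_comp (measurable_powR a) _.
  apply: measurableT_comp => //; apply: measurableT_comp => //.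
  by apply: measurable_funM.
transitivity (\int[mu]_x \int[mu]_c g (x, c))%E.
  rewrite /Gamma_integral integral_indicM; apply: eq_integral => x _.
  have [x0|x0] := ltP 0 x; last first.
    rewrite integral0_eq; last first.
      by move=> c _; rewrite /g/= indic_itvoy ltNge x0 mul0r.
    by rewrite indic_itvoy ltNge x0 mul0r.
  rewrite indic_itvoy x0 mul1r.
  rewrite EFinM -[x in expR (- x)]mul1r -(integral_itvoy_expRM 1 x0).
  rewrite integral_indicM -ge0_integralZl_EFin ?powR_ge0//; last 2 first.
  - by move=> c _; rewrite lee_fin !mulr_ge0 ?expR_ge0// ltW.
  - apply/measurable_EFinP; apply: measurable_funM => //.
    apply: measurable_funM => //; apply: measurableT_comp => //.
    by apply: measurableT_comp => //; exact: measurable_funM.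
  apply: eq_integral => c _; rewrite -EFinM /g/=; congr EFin.
  rewrite [X in _ = X * _]indic_itvoy x0 mul1r.
  rewrite -[in RHS](subrK 1 a) [in RHS]powRD ?(gt_eqF x0) ?implybT// powRr1 ?ltW//.
  by ring.
rewrite (fubini_tonelli (m1 := mu) (m2 := mu) g mg g_ge0) -(integral_itv1y_powRN a0).
rewrite muleC integral_indicM -ge0_integralZl ?Gamma_integral_ge0//; last 2 first.
- apply/measurable_EFinP; apply: measurable_funM => //; exact: measurable_powR.
- by move=> c _; rewrite lee_fin mulr_ge0 ?powR_ge0.
apply: eq_integral => c _; have [c1|c1] := ltP 1 c; last first.
  rewrite integral0_eq; last first.
    by move=> x _; rewrite /g/= [X in _ * (X * _)]indic_itvoy ltNge c1 mul0r mulr0.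
  by rewrite indic_itvoy ltNge c1 mul0r mule0.
rewrite indic_itvoy c1 mul1r muleC.
rewrite -opprD -integral_powR_expR ?(lt_trans ltr01)// [in RHS]integral_indicM.
apply: eq_integral => x _; rewrite /g/= addrK.
by rewrite [X in _ * (X * _)]indic_itvoy c1 mul1r.
Qed.

Lemma pochhammerS a n : pochhammer a n.+1 = pochhammer a n * (a + n%:R).
Proof. by rewrite /pochhammer big_ord_recr. Qed.

Lemma Gamma_integralDn a n : 0 < a ->
  (Gamma_integral (a + n%:R) = (pochhammer a n)%:E * Gamma_integral a)%E.
Proof.
move=> a0; elim: n => [|n IH]; first by rewrite addr0 /pochhammer big_ord0 mul1e.
rewrite -natr1 addrA Gamma_integralD1 ?ltr_wpDr// IH pochhammerS.
by rewrite muleA -EFinM mulrC.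
Qed.

Lemma Gamma_integral1 : (Gamma_integral 1 = 1)%E.
Proof.
have := @integral_itvoy_expRM R 0 1 ltr01; rewrite mul0r oppr0 expR0 => <-.
apply: eq_integral => x _; congr EFin.
by rewrite subrr powRr0 mulr1.
Qed.

(** [fine] sends both infinities to 0, so a nonzero [Gamma_fun a] certifies finiteness. *)
Lemma Gamma_integral_fin a : Gamma_fun a != 0 ->
  Gamma_integral a = (Gamma_fun a)%:E.
Proof.
by rewrite /Gamma_fun /Rintegral -/(Gamma_integral a); case: (Gamma_integral a) => //=; rewrite eqxx.
Qed.

End gamma_integral.

(** * Joint laws *)

Section density_measure.
Context d (T : measurableType d) (R : realType).
Variables (m : {measure set T -> \bar R}) (f : T -> \bar R).
Hypotheses (mf : measurable_fun [set: T] f) (f_ge0 : forall x, (0 <= f x)%E).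

Definition density_measure (A : set T) : \bar R := (\int[m]_(x in A) f x)%E.

Let density_measure0 : density_measure set0 = 0%E.
Proof. exact: integral_set0. Qed.

Let density_measure_ge0 A : (0 <= density_measure A)%E.
Proof. exact: integral_ge0. Qed.

Let density_measure_sigma_additive : semi_sigma_additive density_measure.
Proof. exact: semi_sigma_additive_nng_induced. Qed.

HB.instance Definition _ := isMeasure.Build _ _ _ density_measure
  density_measure0 density_measure_ge0 density_measure_sigma_additive.

End density_measure.

Section product_laws.
Context d1 d2 (T1 : measurableType d1) (T2 : measurableType d2) (R : realType).

(** Rectangles are stable under intersection and generate the product sigma-algebra; the whole space
    is itself a rectangle of finite mass, so a constant sequence exhausts it. *)
Lemma measure_prod_unique (m1 m2 : {measure set (T1 * T2) -> \bar R}) :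
  (m1 setT < +oo)%E ->
  (forall A B, measurable A -> measurable B -> m1 (A `*` B) = m2 (A `*` B)) ->
  forall D, measurable D -> m1 D = m2 D.
Proof.
move=> m1oo m12 D mD.
pose C : set (set (T1 * T2)) := [set A `*` B | A in measurable & B in measurable].
apply: (measure_unique C (fun=> setT)) => //.
- by rewrite measurable_prod_measurableType.
- move=> _ _ [A mA [B mB <-]] [A' mA' [B' mB' <-]]; rewrite -setXI.
  by exists (A `&` A'); [exact: measurableI|exists (B `&` B') => //; exact: measurableI].
- by move=> _; exists setT => //; exists setT => //; rewrite setXTT.
- by rewrite bigcup_const.
- by move=> _ [A mA [B mB <-]]; exact: m12.
Qed.

Context d (T : measurableType d) (P : probability T R).
Variables (V : T -> T1 * T2) (mV : measurable_fun [set: T] V).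

(** With [E] fixed, both sides are finite measures in [D]: the law of [V] under [P] restricted to
    [E], and the law of [V] scaled by [P E]. *)
Lemma indep_event_prod (E : set T) : measurable E ->
  (forall A B, measurable A -> measurable B ->
    (P ((V @^-1` (A `*` B)) `&` E) = P (V @^-1` (A `*` B)) * P E)%E) ->
  forall D, measurable D -> (P ((V @^-1` D) `&` E) = P (V @^-1` D) * P E)%E.
Proof.
move=> mE indE D mD.
have PE : P E = (fine (P E))%:E by rewrite fineK// fin_num_measure.
rewrite muleC PE.
apply: (@measure_prod_unique (pushforward (mrestr P mE) V)
  (mscale (NngNum (fine_ge0 (measure_ge0 P E))) (pushforward P V))) => //.
- rewrite /= /pushforward/= /mrestr preimage_setT setTI.
  by rewrite (le_lt_trans (probability_le1 P mE)) ?ltry.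
- move=> A B mA mB; rewrite /= /pushforward/= /mrestr/= /mscale/= -PE muleC.
  exact: indE.
Qed.

End product_laws.

Definition has_density (R : realType) (m : set R -> \bar R) (f : R -> R) : Prop :=
  [/\ measurable_fun [set: R] f, (forall x, 0 <= f x) &
      forall A, measurable A -> m A = (\int[lebesgue_measure]_(x in A) (f x)%:E)%E].

Section joint_density.
Context d (T : measurableType d) (R : realType) (P : probability T R).
Local Notation mu := (@lebesgue_measure R).
Local Notation mR := (measurableTypeR R).
Variables (X Y : T -> mR) (f g : R -> R).
Hypotheses (mX : measurable_fun [set: T] X) (mY : measurable_fun [set: T] Y).
Hypotheses (Xf : has_density (fun A => P (X @^-1` A)) f).
Hypotheses (Yg : has_density (fun A => P (Y @^-1` A)) g).
Hypothesis XY : forall A B, measurable A -> measurable B ->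
  (P ((X @^-1` A) `&` (Y @^-1` B)) = P (X @^-1` A) * P (Y @^-1` B))%E.

(** On rectangles the iterated integral factors and independence concludes; uniqueness extends this
    to every [D]. Taking for [D] the preimage of a set under addition or division gives the law of a
    sum or a quotient. *)
Lemma joint_density (D : set (mR * mR)) : measurable D ->
  (P ((fun w => (X w, Y w)) @^-1` D) =
   \int[mu]_x \int[mu]_y (\1_D (x, y) * (f x * g y))%:E)%E.
Proof.
move: Xf Yg => [mf f0 fE] [mg g0 gE] mD.
pose h (z : mR * mR) := (f z.1 * g z.2)%:E.
have h0 z : (0 <= h z)%E by rewrite lee_fin mulr_ge0.
have mh : measurable_fun [set: mR * mR] h.
  by apply/measurable_EFinP; apply: measurable_funM; exact: measurableT_comp.
have prodE D' : measurable D' -> (\int[mu \x mu]_(z in D') h z =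
    \int[mu]_x \int[mu]_y (\1_D' (x, y) * (f x * g y))%:E)%E.
  move=> mD'; rewrite integral_indicM fubini_tonelli1//.
  - apply/measurable_EFinP; apply: measurable_funM => //.
    exact/measurable_EFinP.
  - by move=> z; rewrite lee_fin mulr_ge0// mulr_ge0.
rewrite -prodE//.
have mXY : measurable_fun [set: T] (fun w => (X w, Y w)).
  exact: measurable_fun_pair.
apply: (@measure_prod_unique _ _ _ _ _ (pushforward P (fun w => (X w, Y w)))
  (density_measure (mu \x mu)%E h)) => //.
- by rewrite /= /pushforward/= preimage_setT probability_setT ltry.
- move=> A B mA mB; rewrite /= /pushforward/= /density_measure prodE; last exact: measurableX.
  transitivity (P ((X @^-1` A) `&` (Y @^-1` B))); first by congr (P _); apply/seteqP.
  rewrite XY// fE// gE// integral_indicM -ge0_integralZr//; last 3 first.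
  + by apply/measurable_EFinP; exact: measurable_funM.
  + by move=> x _; rewrite lee_fin mulr_ge0.
  + by apply: integral_ge0 => x _; rewrite lee_fin.
  apply: eq_integral => x _.
  rewrite integral_indicM -ge0_integralZl_EFin//; last 3 first.
  + by move=> y _; rewrite lee_fin mulr_ge0.
  + by apply/measurable_EFinP; exact: measurable_funM.
  + by rewrite mulr_ge0.
  apply: eq_integral => y _; rewrite -EFinM; congr EFin.
  rewrite (_ : \1_(A `*` B) (x, y) = \1_A x * \1_B y); first by ring.
  rewrite !indicE -natrM mulnb; congr (nat_of_bool _)%:R.
  by apply/idP/andP; rewrite !inE.
Qed.

End joint_density.

(** * Sums of independent variables *)

Section independent_sums.
Context d (T : measurableType d) (R : realType) (P : probability T R).
Context (I : choiceType) (Z : I -> {RV P >-> R}).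
Hypothesis Zindep : mutually_independent Z.
Local Notation rect J B := (\bigcap_(i in [set` J]) (Z i @^-1` B i)).

Lemma measurable_rect (J : {fset I}) (B : I -> set R) :
  (forall i, measurable (B i)) -> measurable (rect J B).
Proof.
move=> mB; apply: fin_bigcap_measurable => // i _.
by rewrite -[X in measurable X]setTI; exact: measurable_funP.
Qed.

Lemma rectU1 (J : {fset I}) (B : I -> set R) j (C : set R) : j \notin J ->
  rect (j |` J)%fset (fun i => if i == j then C else B i) =
  (Z j @^-1` C) `&` rect J B.
Proof.
move=> jJ; apply/seteqP; split=> w.
  move=> Bw; split.
    by have := Bw j (fset1U1 _ _); rewrite /= eqxx.
  move=> i iJ; have := Bw i (fset1Ur _ iJ); rewrite /=; case: eqP => // ij.
  by move: iJ; rewrite /= ij (negbTE jJ).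
move=> [Cw Bw] i; rewrite /= in_fset1U => /orP[/eqP->|iJ]; first by rewrite eqxx.
case: eqP => [ij|_]; last exact: Bw.
by move: iJ; rewrite ij (negbTE jJ).
Qed.

Lemma probability_rectU1 (J : {fset I}) (B : I -> set R) j (C : set R) :
  j \notin J -> (forall i, measurable (B i)) -> measurable C ->
  (P ((Z j @^-1` C) `&` rect J B) = P (Z j @^-1` C) * P (rect J B))%E.
Proof.
move=> jJ mB mC; rewrite -rectU1// !Zindep//; last first.
  by move=> i; case: ifP.
rewrite big_fsetU1//= eqxx; congr (_ * _)%E.
apply: eq_fbigr => i iJ; case: eqP => // ij.
by move: iJ; rewrite ij (negbTE jJ).
Qed.

Variable e : nat -> I.
Hypothesis e_inj : injective e.

(** The summands are selected through [e] so that the family may also contain variables outside its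
    range, such as the denominator. *)
Definition partial_sum n : T -> R := fun w => \sum_(i < n) Z (e i) w.

Lemma measurable_partial_sum n : measurable_fun [set: T] (partial_sum n).
Proof. exact: measurable_sum. Qed.

Lemma partial_sumS n w : partial_sum n.+1 w = partial_sum n w + Z (e n) w.
Proof. by rewrite /partial_sum big_ord_recr. Qed.

(** Independence from a single variable would not survive the induction: the last summand has to be
    moved from the sum into the finite family [J], so [J] is arbitrary. *)
Lemma indep_partial_sum n (J : {fset I}) (A : set R) (B : I -> set R) :
  (forall i, (i < n)%N -> e i \notin J) -> measurable A ->
  (forall i, measurable (B i)) ->
  (P ((partial_sum n @^-1` A) `&` rect J B) =
   P (partial_sum n @^-1` A) * P (rect J B))%E.
Proof.
elim: n J A B => [|n IH] J A B nJ mA mB.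
  have [A0|A0] := pselect (A 0).
    rewrite (_ : partial_sum 0 @^-1` A = setT); last first.
      by apply/seteqP; split => // w _; rewrite /partial_sum /= big_ord0.
    by rewrite setTI probability_setT mul1e.
  rewrite (_ : partial_sum 0 @^-1` A = set0); last first.
    by apply/seteqP; split => // w; rewrite /partial_sum /= big_ord0.
  by rewrite set0I measure0 mul0e.
have enJ : e n \notin J by exact: nJ.
pose V w := (partial_sum n w, Z (e n) w).
have mV : measurable_fun [set: T] V.
  by apply: measurable_fun_pair => //; exact: measurable_partial_sum.
have mD : measurable ((fun z : R * R => z.1 + z.2) @^-1` A).
  rewrite -[X in measurable X]setTI.
  have : measurable_fun [set: R * R] (fun z : R * R => z.1 + z.2).
    by apply: measurable_funD.
  by apply.
rewrite (_ : _ @^-1` A = V @^-1` ((fun z : R * R => z.1 + z.2) @^-1` A)); last first.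
  by apply/seteqP; split=> w /=; rewrite partial_sumS.
apply: indep_event_prod => //; first exact: measurable_rect.
move=> A' C mA' mC.
have VE : V @^-1` (A' `*` C) = partial_sum n @^-1` A' `&` (Z (e n) @^-1` C).
  by apply/seteqP; split=> w [].
(* The condition on [Z (e n)] joins the rectangle over [J]; once split off again, it is recombined
   with the shorter sum by the induction hypothesis for the singleton [e n]. *)
rewrite VE -setIA -rectU1// IH//; first last.
- by move=> i; case: ifP.
- move=> i ilt; rewrite in_fset1U negb_or nJ; last exact: ltnW.
  by rewrite andbT; apply/eqP => /e_inj ein; rewrite ein ltnn in ilt.
rewrite rectU1// probability_rectU1// muleA; congr (_ * _)%E.
have := IH [fset e n]%fset A' (fun=> C); rewrite set_fset1 bigcap_set1 => ->//.
move=> i ilt; rewrite in_fset1.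
by apply/eqP => /e_inj ein; rewrite ein ltnn in ilt.
Qed.

Lemma indep_partial_sum1 n j (A B : set R) :
  (forall i, (i < n)%N -> e i != j) -> measurable A -> measurable B ->
  (P ((partial_sum n @^-1` A) `&` (Z j @^-1` B)) =
   P (partial_sum n @^-1` A) * P (Z j @^-1` B))%E.
Proof.
move=> nj mA mB.
have := @indep_partial_sum n [fset j]%fset A (fun=> B).
rewrite set_fset1 bigcap_set1; apply => //.
by move=> i ilt; rewrite in_fset1 nj.
Qed.

End independent_sums.

(** * Erlang and gamma-ratio densities *)

Section erlang.
Context {R : realType}.
Local Notation mu := (@lebesgue_measure R).
Local Notation mR := (measurableTypeR R).
Implicit Types (x y s : R) (n : nat).

(* The density of a sum of [n.+1] independent exponential variables. *)
Definition erlang n x : R :=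
  \1_`]0, +oo[ x * (x ^+ n * expR (- x) / n`!%:R).

Lemma erlang_ge0 n x : 0 <= erlang n x.
Proof.
rewrite /erlang indic_itvoy; have [x0|_] := ltP 0 x; last by rewrite mul0r.
by rewrite mul1r divr_ge0// mulr_ge0 ?expR_ge0// exprn_ge0// ltW.
Qed.

Lemma measurable_erlang n : measurable_fun [set: R] (erlang n).
Proof.
apply: measurable_funM => //; apply: measurable_funM => //.
apply: measurable_funM; first exact: measurable_funX.
by apply: measurableT_comp => //; exact: measurableT_comp.
Qed.

Lemma integral_itv0_exprn n s : 0 < s ->
  (\int[mu]_(x in `]0%R, s[) (x ^+ n)%:E = (s ^+ n.+1 / n.+1%:R)%:E)%E.
Proof.
move=> s0.
have dF x : is_derive x 1 (fun x => n.+1%:R^-1 * x ^+ n.+1) (x ^+ n).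
  have dX : is_derive x 1 (fun x : R => x ^+ n.+1) (n.+1%:R * x ^+ n).
    apply: DeriveDef; first exact: exprn_derivable.
    by rewrite exp_derive /GRing.scale/= mulr1.
  apply: is_derive_eq; rewrite /GRing.scale/= mulrA.
  by rewrite mulVf ?mul1r// pnatr_eq0.
have cX k x : {for x, continuous (fun x : R => x ^+ k)}.
  exact: exprn_continuous.
rewrite -(@integral_itv_bndoo _ 0 s _ true false); last first.
  by apply/measurable_EFinP/measurable_funTS; exact: measurable_funX.
rewrite (@continuous_FTC2 _ _ (fun x => n.+1%:R^-1 * x ^+ n.+1))//.
- by rewrite expr0n/= mulr0 sube0 mulrC.
- by apply: continuous_subspaceT => x; exact: cX.
- split.
  + by move=> x _.
  + by apply: cvg_at_right_filter; apply: cvgM; [exact: cvg_cst|exact: cX].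
  + by apply: cvg_at_left_filter; apply: cvgM; [exact: cvg_cst|exact: cX].
- by move=> x _; rewrite derive1E derive_val.
Qed.

(** After the shift [y = s - x] the exponentials multiply to [expR (- s)], free of [x]. What remains
    is the integral of [x ^+ n] over []0, s[], whose factor [n.+1%:R^-1] turns [n!] into
    [(n+1)!]. *)
Lemma erlang_conv n (A : set R) : measurable A ->
  (\int[mu]_x \int[mu]_y (\1_A (x + y) * (erlang n x * erlang 0 y))%:E
   = \int[mu]_(s in A) (erlang n.+1 s)%:E)%E.
Proof.
move=> mA.
pose g (z : mR * mR) := (\1_A z.2 * (erlang n z.1 * erlang 0 (z.2 - z.1)))%:E.
have g_ge0 z : (0 <= g z)%E by rewrite lee_fin mulr_ge0// mulr_ge0 ?erlang_ge0.
have mg : measurable_fun [set: mR * mR] g.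
  apply/measurable_EFinP; apply: measurable_funM.
    by apply: measurableT_comp => //; exact: measurable_indic.
  apply: measurable_funM.
    by apply: measurableT_comp => //; exact: measurable_erlang.
  apply: measurableT_comp; first exact: measurable_erlang.
  exact: measurable_funB.
transitivity (\int[mu]_x \int[mu]_s g (x, s))%E.
  apply: eq_integral => x _.
  rewrite (@ge0_integral_affine _ 1 (- x))//; last 2 first.
  - apply/measurable_EFinP; apply: measurable_funM.
      apply: measurableT_comp; first exact: measurable_indic.
      exact: measurable_funD.
    by apply: measurable_funM => //; exact: measurable_erlang.
  - by move=> y; rewrite lee_fin mulr_ge0// mulr_ge0 ?erlang_ge0.
  rewrite mul1e; apply: eq_integral => s _.
  by rewrite mul1r /g/= addrCA subrr addr0.
rewrite (fubini_tonelli (m1 := mu) (m2 := mu) g mg g_ge0) integral_indicM.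
apply: eq_integral => s _; rewrite /g/=.
pose k := \1_A s * (expR (- s) / n`!%:R).
have k0 : 0 <= k by rewrite mulr_ge0// divr_ge0// expR_ge0.
transitivity (\int[mu]_x (k%:E * (\1_`]0, s[ x * x ^+ n)%:E))%E.
  apply: eq_integral => x _; rewrite -EFinM; congr EFin.
  rewrite /k /erlang !indic_itvoy subr_gt0 indicE [in RHS]indicE.
  rewrite (_ : (x \in `]0, s[%classic) = (0 < x) && (x < s)); last first.
    by apply/idP/idP; rewrite ?in_setE/= in_itv.
  case: (0 < x); case: (x < s); rewrite /= ?mul1r ?mul0r ?mulr0//.
  rewrite fact0 divr1 (_ : - s = - x + - (s - x)); last by ring.
  by rewrite expRD; ring.
have [s0|s0] := ltP 0 s; last first.
  rewrite integral0_eq; last first.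
    move=> x _; rewrite indicE memNset ?mul0r ?mule0//= in_itv/=.
    by move=> /andP[x0 /lt_le_trans/(_ s0)/(lt_trans x0)]; rewrite ltxx.
  by rewrite /erlang indic_itvoy ltNge s0 mul0r mulr0.
rewrite ge0_integralZl_EFin//; last 2 first.
- move=> x _; rewrite lee_fin indicE.
  have [|] := boolP (x \in _); last by rewrite mul0r.
  by rewrite in_setE/= in_itv/= => /andP[x0 _]; rewrite mul1r exprn_ge0// ltW.
- by apply/measurable_EFinP; apply: measurable_funM => //; exact: measurable_funX.
rewrite -integral_indicM integral_itv0_exprn// -EFinM; congr EFin.
rewrite /k /erlang indic_itvoy s0 mul1r factS natrM.
by field; rewrite addrC natr1 !pnatr_eq0 -lt0n fact_gt0.
Qed.

End erlang.

Section gamma_ratio.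
Context {R : realType}.
Local Notation mu := (@lebesgue_measure R).
Local Notation mR := (measurableTypeR R).
Implicit Types (a b x y : R) (n : nat).

Lemma gamma_pdfE a x :
  gamma_pdf a x = \1_`]0, +oo[ x * (x `^ (a - 1) * expR (- x) / Gamma_fun a).
Proof.
by rewrite /gamma_pdf patchE indicE; case: (x \in _); rewrite ?mul1r ?mul0r.
Qed.

Lemma Gamma_fun_ge0 a : 0 <= Gamma_fun a.
Proof. exact: fine_ge0 (Gamma_integral_ge0 a). Qed.

Lemma gamma_pdf_ge0 a x : 0 <= gamma_pdf a x.
Proof.
by rewrite gamma_pdfE mulr_ge0// divr_ge0 ?Gamma_fun_ge0// mulr_ge0 ?powR_ge0 ?expR_ge0.
Qed.

Lemma measurable_gamma_pdf a : measurable_fun [set: R] (gamma_pdf a).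
Proof.
rewrite (_ : gamma_pdf a = fun x => \1_`]0, +oo[ x *
    (x `^ (a - 1) * expR (- x) / Gamma_fun a)); last first.
  by apply/funext => x; rewrite gamma_pdfE.
apply: measurable_funM => //; apply: measurable_funM => //.
by under eq_fun do rewrite -[X in expR (- X)]mul1r; exact: measurable_powR_expR.
Qed.

Lemma gamma_pdf1 : gamma_pdf 1 = erlang 0 :> (R -> R).
Proof.
apply/funext => x; rewrite gamma_pdfE /erlang subrr powRr0.
by rewrite /Gamma_fun /Rintegral -/(Gamma_integral 1) Gamma_integral1 fact0 expr0.
Qed.

(** The beta prime density with parameters [n.+1] and [a], at scale [b]; the Pochhammer symbol
    stands for the quotient of gamma values. *)
Definition gamma_ratio_pdf a b n x : R := \1_`]0, +oo[ x *
  (pochhammer a n.+1 * (x / b) ^+ n / (n`!%:R * b)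
   * (1 + x / b) `^ (- (a + n.+1%:R))).

Lemma measurable_gamma_ratio_pdf a b n :
  measurable_fun [set: R] (gamma_ratio_pdf a b n).
Proof.
apply: measurable_funM => //; apply: measurable_funM.
  apply: measurable_funM => //; apply: measurable_funM => //.
  by apply: measurable_funX; exact: measurable_funM.
apply: (measurableT_comp (measurable_powR _)); apply: measurable_funD => //.
exact: measurable_funM.
Qed.

Lemma pochhammer_gt0 a n : 0 < a -> 0 < pochhammer a n.
Proof. by move=> a0; apply: prodr_gt0 => i _; rewrite ltr_wpDr. Qed.

Lemma gamma_ratio_pdf_ge0 a b n x : 0 < a -> 0 < b ->
  0 <= gamma_ratio_pdf a b n x.
Proof.
move=> a0 b0; rewrite /gamma_ratio_pdf indic_itvoy.
have [x0|_] := ltP 0 x; last by rewrite mul0r.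
rewrite mul1r mulr_ge0 ?powR_ge0// divr_ge0 ?mulr_ge0 ?(ltW (pochhammer_gt0 _ a0)) ?(ltW b0)//.
by rewrite exprn_ge0// divr_ge0// ltW.
Qed.

(** The weight [y / b] is the Jacobian of the substitution to come. It raises the power of [y], and
    the exponentials merge, so that for positive [x] the integrand is an unnormalised gamma density
    of shape [a + n.+1%:R] and rate [1 + x / b]. *)
Lemma gamma_ratio_mixture a b n x : 0 < a -> 0 < b -> Gamma_fun a != 0 ->
  (\int[mu]_y (y / b * (erlang n (y / b * x) * gamma_pdf a y))%:E
   = (gamma_ratio_pdf a b n x)%:E)%E.
Proof.
move=> a0 b0 Ga0; rewrite /gamma_ratio_pdf indic_itvoy.
have [x0|x0] := ltP 0 x; last first.
  rewrite mul0r integral0_eq// => y _; rewrite gamma_pdfE /erlang !indic_itvoy.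
  have [y0|_] := ltP 0 y; last by rewrite mul0r !mulr0.
  by rewrite pmulr_rgt0 ?divr_gt0// ltNge x0 !mul0r mulr0.
rewrite mul1r.
have xb0 : 0 < 1 + x / b by rewrite addr_gt0// divr_gt0.
pose k := (x / b) ^+ n / (n`!%:R * b * Gamma_fun a).
have k0 : 0 <= k.
  rewrite divr_ge0 ?mulr_ge0 ?Gamma_fun_ge0 ?(ltW b0)//.
  by rewrite exprn_ge0// divr_ge0// ltW.
transitivity (\int[mu]_y (k%:E * (\1_`]0, +oo[ y *
    (y `^ (a + n.+1%:R - 1) * expR (- ((1 + x / b) * y))))%:E))%E.
  apply: eq_integral => y _; rewrite gamma_pdfE /erlang !indic_itvoy -EFinM.
  have [y0|_] := ltP 0 y; last by rewrite !mul0r !mulr0.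
  rewrite pmulr_lgt0// divr_gt0//= !mul1r /k; congr EFin.
  rewrite (_ : a + n.+1%:R - 1 = (a - 1) + n.+1%:R); last by ring.
  rewrite [in RHS]powRD ?(gt_eqF y0) ?implybT// powR_mulrn ?(ltW y0)//.
  rewrite (_ : - ((1 + x / b) * y) = - (y / b * x) + - y); last by ring.
  rewrite expRD exprS (_ : y / b * x = y * (x / b)); last by ring.
  rewrite exprMn; move: ((x / b) ^+ n) => t.
  by field; rewrite Ga0 !gt_eqF// ltr0n fact_gt0.
rewrite ge0_integralZl_EFin//; last 2 first.
- by move=> y _; rewrite lee_fin mulr_ge0// mulr_ge0 ?powR_ge0 ?expR_ge0.
- by apply/measurable_EFinP; apply: measurable_funM => //; exact: measurable_powR_expR.
rewrite -integral_indicM integral_powR_expR// Gamma_integralDn//.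
rewrite (Gamma_integral_fin Ga0) -!EFinM; congr EFin; rewrite /k.
by field; rewrite Ga0 !gt_eqF// ltr0n fact_gt0.
Qed.

(** The quotient is linear in [x] once [y] is fixed: one exchange puts [y] outside, the substitution
    of [y / b * x] for [x] turns [b * x / y] into [x], and a second exchange leaves the mixture as
    inner integral. *)
Lemma gamma_ratio_integral a b n (A : set R) :
  0 < a -> 0 < b -> Gamma_fun a != 0 -> measurable A ->
  (\int[mu]_x \int[mu]_y (\1_A (b * x / y) * (erlang n x * gamma_pdf a y))%:E
   = \int[mu]_(x in A) (gamma_ratio_pdf a b n x)%:E)%E.
Proof.
move=> a0 b0 Ga0 mA.
pose g (z : mR * mR) := (\1_A (b * z.1 / z.2) * (erlang n z.1 * gamma_pdf a z.2))%:E.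
have g_ge0 z : (0 <= g z)%E.
  by rewrite lee_fin mulr_ge0// mulr_ge0 ?erlang_ge0 ?gamma_pdf_ge0.
have mg : measurable_fun [set: mR * mR] g.
  apply/measurable_EFinP; apply: measurable_funM.
    apply: measurableT_comp; first exact: measurable_indic.
    apply: measurable_funM; first exact: measurable_funM.
    exact: (measurableT_comp measurable_invr).
  apply: measurable_funM.
    by apply: measurableT_comp => //; exact: measurable_erlang.
  by apply: measurableT_comp => //; exact: measurable_gamma_pdf.
rewrite (fubini_tonelli (m1 := mu) (m2 := mu) g mg g_ge0).
pose h (z : mR * mR) :=
  (\1_A z.1 * (z.2 / b * (erlang n (z.2 / b * z.1) * gamma_pdf a z.2)))%:E.
(* The Jacobian is negative for negative [y]; there the gamma density vanishes. *)
have h_ge0 z : (0 <= h z)%E.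
  rewrite lee_fin mulr_ge0//; have [z0|z0] := ltP 0 z.2.
    rewrite mulr_ge0 ?divr_ge0 ?(ltW z0) ?(ltW b0)//.
    by rewrite mulr_ge0 ?erlang_ge0 ?gamma_pdf_ge0.
  by rewrite gamma_pdfE indic_itvoy ltNge z0 mul0r !mulr0.
have mh : measurable_fun [set: mR * mR] h.
  apply/measurable_EFinP; apply: measurable_funM.
    by apply: measurableT_comp => //; exact: measurable_indic.
  apply: measurable_funM; first exact: measurable_funM.
  apply: measurable_funM.
    apply: measurableT_comp; first exact: measurable_erlang.
    by apply: measurable_funM => //; exact: measurable_funM.
  by apply: measurableT_comp => //; exact: measurable_gamma_pdf.
transitivity (\int[mu]_y \int[mu]_x h (x, y))%E.
  apply: eq_integral => y _; rewrite /g /h/=.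
  have [y0|y0] := ltP 0 y; last first.
    rewrite !integral0_eq// => x _;
    by rewrite gamma_pdfE indic_itvoy ltNge y0 mul0r !mulr0.
  have yb0 : 0 < y / b by rewrite divr_gt0.
  have mF : measurable_fun [set: R]
      (fun x => (\1_A (b * x / y) * (erlang n x * gamma_pdf a y))%:E).
    apply/measurable_EFinP; apply: measurable_funM.
      apply: measurableT_comp; first exact: measurable_indic.
      by apply: measurable_funM => //; exact: measurable_funM.
    by apply: measurable_funM => //; exact: measurable_erlang.
  have F0 x : (0 <= (\1_A (b * x / y) * (erlang n x * gamma_pdf a y))%:E)%E.
    by rewrite lee_fin mulr_ge0// mulr_ge0 ?erlang_ge0 ?gamma_pdf_ge0.
  rewrite (ge0_integral_affine 0 yb0 mF F0) -ge0_integralZl_EFin ?(ltW yb0)//.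
  - apply: eq_integral => x _; rewrite -EFinM addr0; congr EFin.
    rewrite (_ : b * (y / b * x) / y = x); first by ring.
    by field; rewrite !gt_eqF.
  - apply: (measurableT_comp mF); exact: measurable_affine.
rewrite -(fubini_tonelli (m1 := mu) (m2 := mu) h mh h_ge0) integral_indicM.
apply: eq_integral => x _.
rewrite EFinM -(gamma_ratio_mixture n x a0 b0 Ga0) -ge0_integralZl_EFin//.
- move=> y _; rewrite lee_fin.
  have [y0|y0] := ltP 0 y; last first.
    by rewrite gamma_pdfE indic_itvoy ltNge y0 mul0r !mulr0.
  rewrite mulr_ge0 ?divr_ge0 ?(ltW y0) ?(ltW b0)//.
  by rewrite mulr_ge0 ?erlang_ge0 ?gamma_pdf_ge0.
- apply/measurable_EFinP; apply: measurable_funM; first exact: measurable_funM.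
  apply: measurable_funM; last exact: measurable_gamma_pdf.
  apply: measurableT_comp; first exact: measurable_erlang.
  by apply: measurable_funM => //; exact: measurable_funM.
Qed.

End gamma_ratio.

(** * Laws of partial sums and of their quotients by a gamma variable *)

Section gamma_random_variables.
Context d (T : measurableType d) (R : realType) (P : probability T R).
Local Notation mR := (measurableTypeR R).

Lemma gamma_distributed_density a (Y : {RV P >-> R}) :
  gamma_distributed a Y -> has_density (fun A => P (Y @^-1` A)) (gamma_pdf a).
Proof.
move=> Ya; split; [exact: measurable_gamma_pdf|exact: gamma_pdf_ge0|].
exact: Ya.
Qed.

(* Were the normalising constant zero, the density would vanish, as [x / 0 = 0]. *)
Lemma gamma_distributed_Gamma_neq0 a (Y : {RV P >-> R}) :
  gamma_distributed a Y -> Gamma_fun a != 0.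
Proof.
move=> Ya; apply/eqP => Ga0.
have := Ya setT measurableT; rewrite /distribution /pushforward preimage_setT.
rewrite probability_setT integral0_eq => [/eqP|x _].
  by rewrite eqe oner_eq0.
by rewrite gamma_pdfE Ga0 invr0 !mulr0.
Qed.

Context (I : choiceType) (Z : I -> {RV P >-> R}) (e : nat -> I).
Hypotheses (Zindep : mutually_independent Z) (e_inj : injective e).
Hypothesis Z_exp : forall i, gamma_distributed 1 (Z (e i)).

Lemma partial_sum_density n :
  has_density (fun A => P (partial_sum Z e n.+1 @^-1` A)) (erlang n).
Proof.
elim: n => [|n IH].
  rewrite -gamma_pdf1 (_ : partial_sum Z e 1 = Z (e 0%N)).
    exact: gamma_distributed_density.
  by apply/funext => w; rewrite /partial_sum big_ord1.
split; [exact: measurable_erlang|exact: erlang_ge0|move=> A mA].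
have Yd := gamma_distributed_density (Z_exp n.+1); rewrite gamma_pdf1 in Yd.
have mD : measurable ((fun z : mR * mR => z.1 + z.2) @^-1` A).
  rewrite -[X in measurable X]setTI.
  have : measurable_fun [set: mR * mR] (fun z : mR * mR => z.1 + z.2).
    by apply: measurable_funD.
  by apply.
have := joint_density (measurable_partial_sum Z e n.+1)
  (@measurable_funPT _ _ _ _ (Z (e n.+1))) IH Yd _ mD.
rewrite -erlang_conv// => <-.
- congr (P _); rewrite (_ : partial_sum Z e n.+2 =
      fun w => partial_sum Z e n.+1 w + Z (e n.+1) w)//.
  by apply/funext => w; rewrite partial_sumS.
- move=> B C mB mC; apply: indep_partial_sum1 => // i ilt.
  by apply/eqP => /e_inj ein; rewrite ein ltnn in ilt.
Qed.

Lemma scaled_ratio_density a b j n : 0 < a -> 0 < b ->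
  (forall i, e i != j) -> gamma_distributed a (Z j) ->
  has_density (fun A => P ((fun w => b * partial_sum Z e n.+1 w / Z j w) @^-1` A))
    (gamma_ratio_pdf a b n).
Proof.
move=> a0 b0 ej Za.
split; [exact: measurable_gamma_ratio_pdf|by move=> x; exact: gamma_ratio_pdf_ge0|].
move=> A mA.
have mD : measurable ((fun z : mR * mR => b * z.1 / z.2) @^-1` A).
  rewrite -[X in measurable X]setTI.
  have : measurable_fun [set: mR * mR] (fun z : mR * mR => b * z.1 / z.2).
    apply: measurable_funM; first exact: measurable_funM.
    exact: (measurableT_comp measurable_invr).
  by apply.
have := joint_density (measurable_partial_sum Z e n.+1)
  (@measurable_funPT _ _ _ _ (Z j)) (partial_sum_density n)
  (gamma_distributed_density Za) _ mD.
rewrite -gamma_ratio_integral//; last exact: gamma_distributed_Gamma_neq0 Za.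
move=> <-//.
by move=> B C mB mC; exact: indep_partial_sum1.
Qed.

End gamma_random_variables.

(** * The Kummer series as a Poisson mixture *)

Section kummer.
Context {R : realType}.
Implicit Types (a b x z l : R) (n : nat).

(** Splitting off the first factor produces both the prefactor [alpha] and the Kummer parameter
    [1 + alpha]. *)
Lemma pochhammerSl a n : pochhammer a n.+1 = a * pochhammer (1 + a) n.
Proof.
rewrite /pochhammer big_ord_recl addr0; congr (_ * _).
by apply: eq_bigr => i _; rewrite lift0 -natr1 (addrC 1) -addrA (addrC 1).
Qed.

(** Origin of the Kummer parameter 2: the factorial in the Poisson weight of [n.+1]. *)
Lemma pochhammer2 n : pochhammer 2 n = n.+1`!%:R :> R.
Proof.
elim: n => [|n IH]; first by rewrite /pochhammer big_ord0.
by rewrite pochhammerS IH [in RHS]factS natrM mulrC -natrD.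
Qed.

Definition kummer_coeff a z n : R :=
  pochhammer (1 + a) n * z ^+ n / (pochhammer 2 n * n`!%:R).

Lemma kummer_coeff_ge0 a z n : 0 < a -> 0 <= z -> 0 <= kummer_coeff a z n.
Proof.
move=> a0 z0; have p1 := pochhammer_gt0 n (addr_gt0 ltr01 a0).
by rewrite /kummer_coeff pochhammer2 divr_ge0// mulr_ge0 ?exprn_ge0// ltW.
Qed.

(** Factor by factor, [1 + a + n <= (1 + a) * (n + 2)]. The factorial cancels [pochhammer 2 n] in
    the Kummer coefficient, leaving the exponential series at [(1 + a) * z] as majorant. *)
Lemma pochhammer_le_fact a n : 0 < a ->
  pochhammer (1 + a) n <= (1 + a) ^+ n * n.+1`!%:R.
Proof.
move=> a0; elim: n => [|n IH]; first by rewrite /pochhammer big_ord0 mulr1.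
rewrite pochhammerS exprS factS natrM.
have -> : (1 + a) * (1 + a) ^+ n * (n.+2%:R * n.+1`!%:R) =
  ((1 + a) ^+ n * n.+1`!%:R) * ((1 + a) * n.+2%:R) by ring.
apply: ler_pM => //; first by rewrite ltW// pochhammer_gt0// addr_gt0.
  by rewrite addr_ge0// addr_ge0// ltW.
by rewrite -[n.+2]addn2 natrD; have := ler0n R n; nra.
Qed.

Lemma is_cvg_kummer a z : 0 < a -> 0 <= z ->
  cvgn (series (kummer_coeff a z)).
Proof.
move=> a0 z0.
apply: (@series_le_cvg _ _ (exp_coeff ((1 + a) * z))).
- by move=> n; exact: kummer_coeff_ge0.
- by move=> n; rewrite exp_coeff_ge0// mulr_ge0// addr_ge0// ltW.
- move=> n; rewrite /kummer_coeff /exp_coeff/= pochhammer2 exprMn.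
  rewrite ler_pdivrMr ?mulr_gt0 ?ltr0n ?fact_gt0//.
  rewrite (_ : _ / _ * _ = ((1 + a) ^+ n * n.+1`!%:R) * z ^+ n); last first.
    by field; rewrite gt_eqF// ltr0n fact_gt0.
  by rewrite ler_wpM2r ?exprn_ge0// pochhammer_le_fact.
- exact: is_cvg_series_exp_coeff.
Qed.

Definition compound_pdf a b l x : R :=
  a * l * expR (- l) / (b * (1 + x / b) `^ (a + 1))
  * kummer1F1 (1 + a) 2 (l * x / b / (1 + x / b)).

Lemma poisson_mixture a b l x : 0 < a -> 0 < b -> 0 < l -> 0 < x ->
  (\sum_(n <oo) (poisson_pmf l n.+1 * gamma_ratio_pdf a b n x)%:E
   = (compound_pdf a b l x)%:E)%E.
Proof.
move=> a0 b0 l0 x0; rewrite /compound_pdf; set c := _ / _; set z := _ / _ / _.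
have xb0 : 0 < 1 + x / b by rewrite addr_gt0// divr_gt0.
have z0 : 0 <= z by rewrite !divr_ge0 ?mulr_ge0 ?(ltW l0) ?(ltW x0) ?(ltW b0) ?(ltW xb0).
have termE n : poisson_pmf l n.+1 * gamma_ratio_pdf a b n x = c * kummer_coeff a z n.
  rewrite /poisson_pmf l0 /gamma_ratio_pdf indic_itvoy x0 mul1r /c /z /kummer_coeff.
  rewrite pochhammerSl pochhammer2 exprS.
  (* The part [- (a + 1)] of the exponent goes to the constant [c]; the part [- n] supplies the
     denominator of [z ^+ n]. *)
  rewrite (_ : - (a + n.+1%:R) = - (a + 1) - n%:R); last by rewrite -natr1; ring.
  rewrite [in LHS]powRD ?(gt_eqF xb0) ?implybT// !powRN powR_mulrn ?(ltW xb0)//.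
  rewrite -(mulrA l x) !exprMn !exprVn.
  have := powR_gt0 (a + 1) xb0; have := exprn_gt0 n xb0.
  move: ((1 + x / b) ^+ n) ((1 + x / b) `^ (a + 1)) => u v u0 v0.
  by field; rewrite !gt_eqF ?exprn_gt0// ltr0n fact_gt0.
under eq_eseriesr do rewrite termE EFinM.
rewrite nneseriesZl; last by move=> n _; rewrite lee_fin kummer_coeff_ge0.
rewrite [in RHS]EFinM; congr (_ * _)%E; rewrite /kummer1F1.
(* Convergence is what identifies the extended-real sum with the real limit defining [kummer1F1]. *)
rewrite -EFin_lim; last exact: is_cvg_kummer.
by apply/congr_lim/funext => n /=; rewrite sumEFin /series/= big_mkord.
Qed.

End kummer.

(** * Random sums *)

Section random_sums.
Context d (T : measurableType d) (R : realType) (P : probability T R).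
Variables (N : {RV P >-> nat}) (X : nat -> {RV P >-> R}).

(** Measurability of finite sums is applied with [T] carrying the sigma-algebra generated by the
    family, as the independence of [N] concerns only events of that sigma-algebra. *)
Lemma sigma_family_sum n (A : set R) : measurable A ->
  sigma_family X ((fun w => \sum_(i < n) X i w) @^-1` A).
Proof.
move=> mA.
pose G := \bigcup_i preimage_set_system [set: T] (X i) measurable.
have mX i : measurable_fun [set: g_sigma_algebraType G] (X i : _ -> R).
  move=> _ B mB; apply: sub_sigma_algebra; exists i => //.
  by exists B.
have : measurable_fun [set: g_sigma_algebraType G]
    (fun w => \sum_(i < n) (X i : g_sigma_algebraType G -> R) w).
  exact: measurable_sum.
by move=> /(_ measurableT _ mA); rewrite setTI.
Qed.

Hypothesis NX : independent_of_family N X.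

Lemma distribution_random_sum (A : set R) : measurable A ->
  (distribution P (random_sum N X) A = \sum_(n <oo)
    distribution P N [set n] * P ((fun w => \sum_(i < n) X i w)%R @^-1` A))%E.
Proof.
move=> mA; pose F n := (N @^-1` [set n]) `&` ((fun w => \sum_(i < n) X i w) @^-1` A).
have mF n : measurable (F n).
  apply: measurableI.
    by rewrite -[X in measurable X]setTI; exact: measurable_funP.
  have : measurable_fun [set: T] (fun w => \sum_(i < n) X i w).
    exact: measurable_sum.
  by move=> /(_ measurableT _ mA); rewrite setTI.
transitivity (P (\bigcup_n F n)).
  congr (P _); apply/seteqP; split=> [w Aw|w [n _ [/= Nn Aw]]].
    by exists (N w).
  by rewrite /= /random_sum Nn.
rewrite measure_semi_bigcup//.
- by apply: eq_eseriesr => n _; apply: NX => //; exact: sigma_family_sum.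
- apply/trivIsetP => i j _ _ ij; apply/seteqP; split => // w.
  by move=> [[/= Ni _] [/= Nj _]]; rewrite -Ni -Nj eqxx in ij.
- exact: bigcupT_measurable.
Qed.

End random_sums.

Theorem theorem3 (R : realType) (d : measure_display) (T : measurableType d)
    (P : probability T R) (alpha beta lambda : R)
    (Yalpha : {RV P >-> R}) (Y : nat -> {RV P >-> R}) (N : {RV P >-> nat})
    (alpha_gt0 : 0 < alpha) (beta_gt0 : 0 < beta) (lambda_gt0 : 0 < lambda)
    (Yalpha_gamma : gamma_distributed alpha Yalpha)
    (Y_gamma : forall i, gamma_distributed 1 (Y i))
    (Y_indep : mutually_independent
       (fun i : option nat => if i is Some j then Y j else Yalpha))
    (N_poisson : poisson_distributed lambda N) :
  let X := (fun i => scaled_ratio beta (Y i) Yalpha) : nat -> {RV P >-> R} in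
  let S := random_sum N X : {RV P >-> R} in
  independent_of_family N X ->
  distribution P S [set 0] = (expR (- lambda))%:E /\
  (forall A : set R, measurable A -> A `<=` `]0, +oo[ ->
     distribution P S A =
     (\int[lebesgue_measure]_(x in A)
        (alpha * lambda * expR (- lambda)
           / (beta * (1 + x / beta) `^ (alpha + 1))
         * kummer1F1 (1 + alpha) 2
             (lambda * x / beta / (1 + x / beta)))%:E)%E).
Proof.
move=> X S NX.
pose W n : T -> R := fun w => \sum_(i < n) X i w.
have Wdens n : has_density (fun A => P (W n.+1 @^-1` A)) (gamma_ratio_pdf alpha beta n).
  (* [Some] enumerates the numerators; [None], outside its range, indexes [Yalpha]. *)
  have := @scaled_ratio_density _ _ _ _ _ _ Some Y_indep
    (fun i j (ij : Some i = Some j) => Some_inj ij) Y_gamma alpha beta None n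
    alpha_gt0 beta_gt0 (fun=> isT) Yalpha_gamma.
  rewrite (_ : (fun w => _) = W n.+1)//; apply/funext => w.
  rewrite /W /partial_sum mulr_sumr mulr_suml; apply: eq_bigr => i _.
  by [].
have SE A : measurable A -> distribution P S A = ((poisson_pmf lambda 0)%:E *
    P (W 0%N @^-1` A) + \sum_(n <oo) \int[lebesgue_measure]_(x in A)
      (poisson_pmf lambda n.+1 * gamma_ratio_pdf alpha beta n x)%:E)%E.
  move=> mA; rewrite (distribution_random_sum NX mA) nneseries_recl//; last first.
    by move=> n _; rewrite mule_ge0.
  rewrite N_poisson; congr (_ + _)%E.
  rewrite -(nneseries_addn 1); last by move=> n; rewrite mule_ge0.
  apply: eq_eseriesr => n _; rewrite addn1 N_poisson.
  have [mf f0 fE] := Wdens n; rewrite -/(W n.+1) fE// -ge0_integralZl_EFin//.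
  - by move=> x _; rewrite lee_fin.
  - by apply/measurable_EFinP; exact: measurable_funTS.
  - exact: poisson_pmf_ge0.
split.
  rewrite SE//.
  (* For positive values of [N] the sum has a density, so it does not charge the point 0; the atom
     comes from [N = 0] alone. *)
  rewrite eseries0 ?adde0; last by move=> n _ _; exact: integral_set1.
  rewrite (_ : W 0%N @^-1` [set 0] = setT).
    by rewrite probability_setT mule1 /poisson_pmf lambda_gt0 expr0 fact0 invr1 !mul1r.
  by apply/seteqP; split => // w _; rewrite /W /= big_ord0.
move=> A mA A0; rewrite SE//.
rewrite (_ : W 0%N @^-1` A = set0); last first.
  apply/seteqP; split => // w; rewrite /W /= big_ord0 => /A0.
  by rewrite /= in_itv/= ltxx.
(* Nonnegative terms let the series move under the integral, reducing the claim to a pointwise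
   identity at positive [x]. *)
rewrite measure0 mule0 add0e -integral_nneseries//; last 2 first.
- move=> n; have [mf _ _] := Wdens n; apply/measurable_EFinP/measurable_funTS.
  exact: measurable_funM.
- move=> n x _; have [_ f0 _] := Wdens n.
  by rewrite lee_fin mulr_ge0// poisson_pmf_ge0.
apply: eq_integral => x /set_mem/A0; rewrite /= in_itv/= andbT => x0.
exact: poisson_mixture.
Qed.
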